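(* Let $a_1,\dots,a_k$ be positive integers and suppose that $f(z)$ is a real polynomial of degree $a_1+\dots+a_k$ with distinct (complex) roots. Let $n$ be the number of real factorizations $f_1(z)f_2(z)\cdots f_k(z)=f(z)$ of $f$, where $f_i$ is a real polynomial of degree $a_i$ for $i=1,\dots,k$. Then $n$ depends only on the number of real roots of $f(z)$ and satisfies $$\binom{\lfloor\frac{a_1+\dots+a_k}{2}\rfloor}{\lfloor\frac{a_1}{2}\rfloor,\dots,\lfloor\frac{a_k}{2}\rfloor}\ \le\ n\ \le\ \binom{a_1+a_2+\dots+a_k}{a_1,a_2,\dots,a_k}.$$ The minimum is attained when $f(z)$ has at most one real root, and the maximum occurs when $f(z)$ has all roots real. Moreover, at most $$1+\left\lfloor\frac{a_1}{2}\right\rfloor+\left\lfloor\frac{a_2}{2}\right\rfloor+\dots+\left\lfloor\frac{a_k}{2}\right\rfloor$$ distinct values of $n$ can occur.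
   Context: Factorizations are counted as ordered $k$-tuples $(f_1,\dots,f_k)$ up to rescaling the factors by nonzero constants; equivalently, as distributions of the roots of $f$ among the $k$ factors, with $f_i$ receiving $a_i$ roots (and, for real factorizations, each complex conjugate pair of roots going to the same factor). Convention: the multinomial coefficient $\binom{B}{b_1,\dots,b_k}$ equals $\frac{B!}{b_1!\cdots b_k!}$ if $B=b_1+\dots+b_k$, and it is $0$ if $B\ne b_1+\dots+b_k$.
   Formalization: The last bound is proved for the number of distinct nonzero values of n: as written it fails when two or more a_i are odd (for a=(1,1) the bound is 1, but z²+1 gives n=0 and z²-1 gives n=2); if at most one a_i is odd, n is never 0 and the bound is as stated. *)

(* Defs.v *)
From HB Require Import structures.
From mathcomp Require Import all_boot all_order all_algebra.
From mathcomp Require Import finmap.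
From mathcomp Require Import boolp classical_sets functions cardinality reals.
From mathcomp Require Import polyrcf complex.

Set Implicit Arguments.
Unset Strict Implicit.
Unset Printing Implicit Defensive.

Import Order.TTheory GRing.Theory Num.Theory.

Local Open Scope classical_set_scope.
Local Open Scope ring_scope.

(* The division is exact in the first branch; the value is 0 when the lower
   entries do not add up to B. *)
Definition multinomial (k B : nat) (b : 'I_k -> nat) : nat :=
  (if B == \sum_(i < k) b i then B`! %/ \prod_(i < k) (b i)`! else 0)%N.

Section RealFactorizations.
Variables (R : realType) (k : nat) (a : 'I_k -> nat).
Implicit Types (f : {poly R}) (F G : {ffun 'I_k -> {poly R}}).

Definition complex_poly f : {poly R[i]} := map_poly (real_complex R) f.

(* The list of all complex roots, taken with multiplicity, has no repetition. *)
Definition distinct_complex_roots f : Prop :=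
  exists2 rs : seq R[i], uniq rs &
    complex_poly f =
      lead_coef (complex_poly f) *: \prod_(z <- rs) ('X - z%:P).

Definition all_roots_real f : Prop :=
  forall z : R[i], root (complex_poly f) z -> z \is Num.real.

(* Distinct real roots of f, for f != 0 (rootsR 0 is empty). *)
Definition num_real_roots f : nat := size (rootsR f).

(* deg p = d is size p = d.+1. *)
Definition admissible f : Prop :=
  size f = (\sum_(i < k) a i).+1 /\ distinct_complex_roots f.

Definition is_real_factorization f F : Prop :=
  (forall i, size (F i) = (a i).+1) /\ \prod_(i < k) F i = f.

Definition rescaled F G : Prop :=
  exists2 c : 'I_k -> R, (forall i, c i != 0) & forall i, G i = c i *: F i.

(* The equivalence classes, under [rescaled], of the factorizations of f. *)
Definition real_factorizations f : set (set {ffun 'I_k -> {poly R}}) :=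
  [set [set G | is_real_factorization f G /\ rescaled F G]
  | F in [set F | is_real_factorization f F]].

(* [fset_set] is empty on infinite sets, so this is the cardinality only
   together with [finite_set (real_factorizations f)]. *)
Definition num_real_factorizations f : nat :=
  #|` fset_set (real_factorizations f)|.

(* The values of the count over all admissible f, except 0. Zero has to be left
   out of the bound 1 + \sum_i (a i)./2 on the number of values: for
   a = (1, 1) that bound is 1, but z^2 + 1 has 0 real factorizations and
   z^2 - 1 has 2. If at most one a i is odd, 0 is not a value. *)
Definition nonzero_values : set nat :=
  [set num_real_factorizations f | f in [set f | admissible f]] `\ 0%N.

End RealFactorizations.

(* Main.v *)
(* Up to rescaling, a real factorization of f distributes the monic irreducible
   factors of f (one linear factor per real root, one quadratic factor per
   conjugate pair) among k boxes so that the degrees in box i add up to a i.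
   With r real roots and s pairs, n is therefore the number of ways to fill boxes
   of capacities a with r labelled items of weight 1 and s of weight 2.
   Cutting an item of weight 2 into two items of weight 1 can only increase this
   number, which gives the two bounds at s = 0 and r <= 1. Each box of odd
   capacity needs an item of weight 1, so n <> 0 forces r >= #{i | a i odd};
   since r also has the parity of the degree, this leaves
   1 + \sum_i (a i)./2 values of r. *)

Require Import Defs.
From HB Require Import structures.
From mathcomp Require Import all_boot all_order all_algebra.
From mathcomp Require Import finmap.
From mathcomp Require Import boolp classical_sets functions cardinality reals.
From mathcomp Require Import polyrcf complex.
From mathcomp Require Import zify ring.

Import Order.TTheory GRing.Theory Num.Theory.

(** * Filling boxes exactly with labelled weighted items *)

Section Fillings.
Variable k : nat.
Implicit Types (a : 'I_k -> nat) (ws : seq nat).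
Local Open Scope nat_scope.

(** The first item goes to some box [i], whose capacity drops by its weight; the guard [w <= a i]
    keeps the truncated subtraction exact. With no items left, all boxes must be full. *)
Fixpoint fillings ws a : nat :=
  if ws is w :: ws' then
    \sum_(i | w <= a i) fillings ws' (fun j => a j - (i == j) * w)
  else [forall i, a i == 0].

Lemma ffun_ord_recl n (P : pred {ffun 'I_n.+1 -> 'I_k}) :
  #|[set phi | P phi]| =
  \sum_i #|[set psi : {ffun 'I_n -> 'I_k} |
             P [ffun j => oapp psi i (unlift ord0 j)]]|.
Proof.
pose h (p : 'I_k * {ffun 'I_n -> 'I_k}) : {ffun 'I_n.+1 -> 'I_k} :=
  [ffun j => oapp p.2 p.1 (unlift ord0 j)].
have hbij : bijective h.
  exists (fun phi : {ffun 'I_n.+1 -> 'I_k} =>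
           (phi ord0, [ffun j : 'I_n => phi (lift ord0 j)])) => [[i psi]|phi].
    rewrite /h; congr (_, _); first by rewrite ffunE unlift_none.
    by apply/ffunP => j; rewrite !ffunE liftK.
  apply/ffunP => j; rewrite ffunE.
  by case: unliftP => [j' ->|->] //=; rewrite ffunE.
rewrite -sum1_card (reindex h) /=; last exact: onW_bij.
under eq_bigl do rewrite inE.
rewrite -(pair_big_dep xpredT (fun i psi => P (h (i, psi))) (fun=> fun=> 1)) /=.
apply: eq_bigr => i _; rewrite -sum1_card.
by apply: eq_bigl => psi; rewrite inE.
Qed.

(** Ties the recursion to actual assignments of items to boxes, the form in which factorizations
    appear; the induction splits an assignment by the box of its first item. *)
Lemma card_fillings ws a :
  #|[set phi : {ffun 'I_(size ws) -> 'I_k} |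
      [forall i, \sum_(j | phi j == i) nth 0 ws j == a i]]| = fillings ws a.
Proof.
elim: ws a => [|w ws IH] a /=.
  have [Pa|Pa] := boolP [forall i, a i == 0].
    rewrite (_ : [set _ | _] = [set: _])%SET ?cardsT ?card_ffun ?card_ord //.
    apply/setP => phi; rewrite !inE; apply/forallP => i.
    by rewrite (eqP (forallP Pa i)) big1 // => -[].
  apply: eq_card0 => phi; rewrite !inE; apply: contraNF Pa => /forallP Pa.
  by apply/forallP => i; rewrite -(eqP (Pa i)) big1 // => -[].
rewrite ffun_ord_recl [RHS]big_mkcond; apply: eq_bigr => i _.
have P psi i' :
    (\sum_(j < (size ws).+1 |
       [ffun j => oapp (psi : {ffun _ -> _}) i (unlift ord0 j)] j == i')
       nth 0 (w :: ws) j) =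
    (i == i') * w + \sum_(j < size ws | psi j == i') nth 0 ws j.
  rewrite big_mkcond big_ord_recl ffunE unlift_none /= [in RHS]big_mkcond /=.
  congr (_ + _); first by case: ifP => _; rewrite ?mul1n ?mul0n.
  by apply: eq_bigr => j _; rewrite ffunE liftK.
have [wa|wa] := leqP w (a i); last first.
  apply: eq_card0 => psi; rewrite inE; apply/negbTE/forallPn; exists i.
  by rewrite P eqxx mul1n; lia.
rewrite -IH; apply: eq_card => psi; rewrite !inE.
apply/eq_forallb => i'; rewrite P.
by have [<-|ne] := eqVneq i i';
  rewrite ?mul1n ?mul0n ?subn0 // -{1}(subnKC wa) eqn_add2l.
Qed.

(** Placements of an item of weight [v + w] correspond to the placements of the two pieces in which
    both land in the same box. *)
Lemma fillings_split ws1 v w ws2 a :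
  fillings (ws1 ++ v + w :: ws2) a <= fillings (ws1 ++ [:: v, w & ws2]) a.
Proof.
elim: ws1 a => [|x ws1 IH] a /=; last by apply: leq_sum => i _.
rewrite [leqLHS]big_mkcond [leqRHS]big_mkcond; apply: leq_sum => i _ /=.
case: ifP => // vw; rewrite ifT; last by lia.
rewrite (bigD1 i) ?eqxx /=; last by lia.
apply: leq_trans (leq_addr _ _).
rewrite (_ : (fun j => _) =
             (fun j => a j - (i == j) * v - (i == j) * w)) //.
by apply/funext => j; rewrite mulnDr subnDA.
Qed.

(** Placing an item changes the parity of at most one capacity, and only if its weight is odd; at
    the end all capacities are 0. *)
Lemma odd_fillings ws a :
  fillings ws a != 0 -> \sum_i odd (a i) <= count odd ws.
Proof.
elim: ws a => [|w ws IH] a /=.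
  have [/forallP a0 _|//] := boolP [forall i, a i == 0].
  by rewrite big1 // => i _; rewrite (eqP (a0 i)).
move=> ne0; case: (pickP [pred i |
    (w <= a i) && (fillings ws (fun j => a j - (i == j) * w) != 0)])
  => [i /= /andP[wa /IH le]|none]; last first.
  move: ne0; rewrite big1 // => i wa; apply/eqP.
  by have := none i; rewrite /= wa /= => /negbFE.
apply: leq_trans (leq_add (leqnn _) le).
rewrite (bigD1 i) //= (bigD1 i (P := xpredT)) //= eqxx mul1n addnA leq_add //.
  by rewrite oddB //; case: odd; case: odd.
by apply: leq_sum => j ji; rewrite eq_sym (negbTE ji) subn0.
Qed.

Lemma fillings_nseq1_fact n a :
  fillings (nseq n 1) a * \prod_i (a i)`! = (n == \sum_i a i) * n`!.
Proof.
elim: n a => [|n IH] a /=.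
  rewrite muln1 [0 == _]eq_sym sum_nat_eq0.
  have [/forallP a0|] := boolP [forall i, a i == 0]; last by rewrite mul0n.
  by rewrite big1 // => i _; rewrite (eqP (a0 i)).
have sumD i : 0 < a i -> \sum_j a j = (\sum_j (a j - (i == j) * 1)).+1.
  move=> ai; rewrite (bigD1 i) //= (bigD1 i (P := xpredT)) //= eqxx mul1n -addSn.
  congr (_ + _); first lia.
  by apply: eq_bigr => j ji; rewrite eq_sym (negbTE ji) subn0.
(* Putting a unit item in box [i] turns [(a i)!] into [a i * (a i - 1)!], so the factor [a i] comes
   out and the induction hypothesis absorbs the rest. Boxes with [a i = 0] contribute nothing to the
   sum of the [a i]. *)
transitivity (\sum_(i | 0 < a i) a i * ((n.+1 == \sum_i a i) * n`!)).
  rewrite big_distrl; apply: eq_bigr => i ai /=.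
  rewrite (sumD _ ai) eqSS -IH mulnCA; congr (_ * _).
  rewrite (bigD1 i) //= [in RHS](bigD1 i) //= mulnA eqxx mul1n; congr (_ * _).
    by case: (a i) ai => // m _; rewrite factS subn1.
  by apply: eq_bigr => j ji; rewrite eq_sym (negbTE ji) subn0.
rewrite -big_distrl big_mkcond /=.
rewrite (eq_bigr a) => [|i _]; last by case: (a i).
by case: eqP => [<-|]; rewrite ?muln0 // !mul1n factS.
Qed.

Lemma fillings_nseq1 n a : fillings (nseq n 1) a = multinomial n a.
Proof.
have := fillings_nseq1_fact n a; rewrite /multinomial.
have P0 : 0 < \prod_i (a i)`! by rewrite prodn_gt0 // => i; apply: fact_gt0.
case: ifP => _; first by rewrite mul1n => <-; rewrite mulnK.
by move/eqP; rewrite mul0n muln_eq0 (gtn_eqF P0) orbF => /eqP.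
Qed.

(** An odd box cannot be filled by items of weight 2; if all boxes are even, halving weights and
    capacities reduces to unit items. *)
Lemma fillings_nseq2 n a :
  fillings (nseq n 2) a =
  if [forall i, ~~ odd (a i)] then multinomial n (fun i => (a i)./2) else 0.
Proof.
rewrite -fillings_nseq1; elim: n a => [|n IH] a /=.
  case: ifP => [/forallP ev|/negbT/forallPn[i ai]].
    by congr nat_of_bool; apply: eq_forallb => i; have := ev i; lia.
  by rewrite (introF forallP) // => /(_ i); lia.
case: ifP => [/forallP ev|/negbT/forallPn[i ai]].
  apply: eq_big => [i|i ai]; first by have := ev i; lia.
  rewrite IH ifT.
    by congr fillings; apply/funext => j; have := ev j; case: (i == j); lia.
  by apply/forallP => j; have := ev j; case: (i == j); lia.
apply: big1 => j aj; rewrite IH ifF //; apply/negbTE/forallPn; exists i.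
by rewrite oddB ?oddM ?andbF ?addbF //; case: eqVneq => // <-; rewrite mul1n.
Qed.

Lemma sum_oddE a : \sum_i a i = \sum_i odd (a i) + (\sum_i (a i)./2).*2.
Proof.
rewrite -muln2 big_distrl -big_split; apply: eq_bigr => i _ /=.
by rewrite muln2 odd_double_half.
Qed.

Lemma fillings_1nseq2 n a : \sum_i a i = n.*2.+1 ->
  fillings (1 :: nseq n 2) a = multinomial n (fun i => (a i)./2).
Proof.
move=> sa /=; have := sum_oddE a; rewrite sa => odd_sum.
(* The halves add up to [n] exactly when one capacity is odd. The unit item must then go to that
   box, which leaves its half unchanged. *)
rewrite /multinomial; have [sn|sn] := eqVneq n (\sum_i (a i)./2).
  have /eqP/sum_nat_eq1[i [_ oi ev]] : \sum_i odd (a i) = 1 by lia.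
  have ai : 0 < a i by lia.
  rewrite (bigD1 i) //= [X in _ + X]big1 => [|j /andP[aj ji]]; last first.
    rewrite fillings_nseq2 ifF //; apply/negbTE/forallPn; exists i.
    by rewrite (negbTE ji) subn0; lia.
  rewrite addn0 fillings_nseq2 ifT.
    have half : (fun j => (a j - (i == j) * 1)./2) = (fun j => (a j)./2).
      apply/funext => j; have [<-|] := eqVneq i j; last by rewrite subn0.
      by lia.
    transitivity (multinomial n (fun j => (a j)./2)); first by rewrite -half.
    by rewrite /multinomial ifT //; apply/eqP.
  apply/forallP => j; have [<-|ij] := eqVneq i j; first by lia.
  by have := ev j; rewrite eq_sym => /(_ ij isT); lia.
(* If placing the unit item in box [i] made all capacities even, [i] would be the only odd box,
   contrary to [sn]. *)
apply: big1 => i ai; rewrite fillings_nseq2; case: ifP => // /forallP ev.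
suff o1 : \sum_i odd (a i) = 1 by lia.
apply/eqP/sum_nat_eq1; exists i; split => // [|j ji _].
  by have := ev i; rewrite eqxx; lia.
by have := ev j; rewrite eq_sym (negbTE ji); lia.
Qed.

Definition fillings12 a r s := fillings (nseq r 1 ++ nseq s 2) a.

Lemma fillings12_split a r s : fillings12 a r s.+1 <= fillings12 a r.+2 s.
Proof.
rewrite /fillings12 (_ : nseq r.+2 1 = nseq r 1 ++ nseq 2 1) -?catA.
  exact: fillings_split.
by rewrite -nseqD addn2.
Qed.

Lemma fillings12_le a r s m : fillings12 a r (m + s) <= fillings12 a (m.*2 + r) s.
Proof.
elim: m r => [|m IH] r //.
apply: leq_trans (fillings12_split _ _ _) _.
by have := IH r.+2; rewrite doubleS !addSn !addnS.
Qed.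

Lemma fillings12_odd a r s : fillings12 a r s != 0 ->
  \sum_i odd (a i) <= r.
Proof.
by move/odd_fillings; rewrite count_cat !count_nseq /= mul1n mul0n addn0.
Qed.

Lemma fillings12_min a r s : \sum_i a i = r + s.*2 -> r <= 1 ->
  fillings12 a r s = multinomial (\sum_i a i)./2 (fun i => (a i)./2).
Proof.
move=> sa; case: r sa => [|[|//]] sa _.
  rewrite sa doubleK /fillings12 fillings_nseq2; case: ifP => //.
  (* With an odd box there is no filling, and the halves fall short of [s], so the multinomial is 0
     by convention. *)
  case/negbT/forallPn => i; rewrite negbK => ai.
  rewrite /multinomial /=; case: eqP => // sE; have := sum_oddE a.
  by rewrite sa [X in _ = X + _](bigD1 i) //= ai -sE; lia.
rewrite sa (_ : (0.+1 + s.*2)./2 = s); last by lia.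
exact: fillings_1nseq2.
Qed.

Lemma fillings12_max a r : fillings12 a r 0 = multinomial r a.
Proof. by rewrite /fillings12 cats0 fillings_nseq1. Qed.

End Fillings.

Arguments fillings {k}.
Arguments fillings12 {k}.

(** * Divisibility by products of pairwise coprime irreducible polynomials *)

Section CoprimeProducts.
Variables (F : fieldType) (J : finType) (q : J -> {poly F}).
Hypothesis q_irr : forall j, irreducible_poly (q j).
Hypothesis q_coprime : forall j j', j != j' -> coprimep (q j) (q j').
Local Open Scope ring_scope.

Lemma irreducible_dvdp_prod (I : finType) (G : I -> {poly F}) j :
  q j %| \prod_i G i -> exists i, q j %| G i.
Proof.
apply: contraPP => /forallNP no; apply/negP.
rewrite -irreducible_poly_coprime //.
elim/big_rec: _ => [|i p _ cop]; first exact: coprimep1.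
by rewrite coprimepMr cop andbT irreducible_poly_coprime //; apply/negP.
Qed.

(** Lets divisibility recover which irreducibles occur in a subproduct: [q j] is coprime to every
    other [q l]. *)
Lemma dvdp_prod_sub (P : pred J) j : q j %| \prod_(l | P l) q l -> P j.
Proof.
apply: contraTT => Pj; rewrite -irreducible_poly_coprime //.
elim/big_rec: _ => [|i p Pi cop]; first exact: coprimep1.
rewrite coprimepMr cop andbT q_coprime //.
by apply: contraNneq Pj => ->.
Qed.

Lemma prod_dvdp_coprime (P : pred J) p :
  (forall j, P j -> q j %| p) -> \prod_(j | P j) q j %| p.
Proof.
move=> qp; rewrite -big_filter.
have: uniq [seq j <- index_enum J | P j] by rewrite filter_uniq ?index_enum_uniq.
have: forall j, j \in [seq j <- index_enum J | P j] -> q j %| p.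
  by move=> j; rewrite mem_filter => /andP[/qp].
elim: [seq _ <- _ | _] => [|j s IH] qs /=; first by rewrite big_nil dvd1p.
case/andP=> js us; rewrite big_cons Gauss_dvdp.
  by rewrite qs ?mem_head // IH // => l ls; rewrite qs // inE ls orbT.
rewrite big_seq; elim/big_rec: _ => [|i r si cop]; first exact: coprimep1.
rewrite coprimepMr cop andbT q_coprime //.
by apply: contraNneq js => ->.
Qed.

Lemma size_prod_irreducible (P : pred J) :
  size (\prod_(j | P j) q j) = (\sum_(j | P j) (size (q j)).-1).+1.
Proof.
elim/big_rec2: _ => [|j n p _ IH]; first by rewrite size_poly1.
have q0 := irredp_neq0 (q_irr j).
rewrite size_mul //; last by rewrite -size_poly_gt0 IH.
by rewrite IH -(ltn_predK (_ : (0 < size (q j))%N)) ?size_poly_gt0 //= addnS.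
Qed.

End CoprimeProducts.

(** * Factorization classes as assignments of irreducible factors *)

Section CountFactorizations.
Variables (R : realType) (k : nat) (a : 'I_k -> nat) (i0 : 'I_k).
Variables (J : finType) (q : J -> {poly R}) (c : R).
Hypothesis q_irr : forall j, irreducible_poly (q j).
Hypothesis q_coprime : forall j j', j != j' -> coprimep (q j) (q j').
Hypothesis c_neq0 : c != 0%R.
Local Open Scope ring_scope.

Let f := c *: \prod_j q j.

Let good := [set phi : {ffun J -> 'I_k} |
  [forall i, (\sum_(j | phi j == i) (size (q j)).-1)%N == a i]].

Let part (phi : {ffun J -> 'I_k}) i := \prod_(j | phi j == i) q j.

(* The leading coefficient of f is given to the factor of index i0. *)
Let factorization phi : {ffun 'I_k -> {poly R}} :=
  [ffun i => (if i == i0 then c else 1) *: part phi i].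

Let fclass (F : {ffun 'I_k -> {poly R}}) : set {ffun 'I_k -> {poly R}} :=
  ([set G | is_real_factorization a f G /\ rescaled F G])%classic.

Let prod_part phi : \prod_i part phi i = \prod_j q j.
Proof. by rewrite [RHS](partition_big (fun j => phi j) xpredT). Qed.

(** Up to rescaling, the constant [c] can be forgotten and the plain products [part phi] used
    instead. *)
Let factorization_rescaled phi : rescaled (finfun (part phi)) (factorization phi).
Proof.
exists (fun i => if i == i0 then c else 1); last by move=> i; rewrite !ffunE.
by move=> i; case: ifP => _ //; rewrite oner_eq0.
Qed.

Let rescaled_sym (F G : {ffun 'I_k -> {poly R}}) : rescaled F G -> rescaled G F.
Proof.
case=> d d0 E; exists (fun i => (d i)^-1) => i; first by rewrite invr_eq0.
by rewrite E scalerA mulVf // scale1r.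
Qed.

Let rescaled_trans (F G H : {ffun 'I_k -> {poly R}}) :
  rescaled F G -> rescaled G H -> rescaled F H.
Proof.
case=> d d0 E [d' d'0 E']; exists (fun i => d' i * d i) => i.
  by rewrite mulf_neq0.
by rewrite E' E scalerA.
Qed.

Let factorizationP phi :
  phi \in good <-> is_real_factorization a f (factorization phi).
Proof.
have sz i : size (factorization phi i) =
    (\sum_(j | phi j == i) (size (q j)).-1).+1.
  rewrite ffunE size_scale ?size_prod_irreducible //.
  by case: ifP => _ //; rewrite oner_eq0.
split=> [|[szF _]]; last first.
  by rewrite inE; apply/forallP => i; have := szF i; rewrite sz => -[->].
rewrite inE => /forallP g; split=> [i|]; first by rewrite sz (eqP (g i)).
rewrite (eq_bigr (fun i => (if i == i0 then c else 1)%:P * part phi i)).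
  rewrite big_split prod_part /= (bigD1 i0) //= eqxx big1 ?mulr1 ?mul_polyC //.
  by move=> i /negbTE ->.
by move=> i _; rewrite ffunE mul_polyC.
Qed.

Let fclass_inj phi psi : is_real_factorization a f (factorization phi) ->
  fclass (factorization phi) = fclass (factorization psi) -> phi = psi.
Proof.
move=> Fphi E; have: fclass (factorization psi) (factorization phi).
  by rewrite -E; split=> //; exists (fun=> 1) => i; rewrite ?oner_eq0 ?scale1r.
case=> _ /(rescaled_trans _ _ _ (factorization_rescaled psi)).
move/rescaled_trans => /(_ _ (rescaled_sym _ _ (factorization_rescaled phi))).
case=> d d0 P; apply/ffunP => j; apply/esym/eqP.
(* [part phi (phi j)] is divisible by [q j] and proportional to [part psi (phi j)], so [psi] also
   sends [j] to [phi j]. *)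
apply: (@dvdp_prod_sub _ _ q q_irr q_coprime (fun l => psi l == phi j)).
have := P (phi j); rewrite !ffunE /part => D.
rewrite -(dvdpZr _ _ (d0 (phi j))) -D (bigD1 j) //=.
exact: dvdp_mulr.
Qed.

(** Each [q j] is sent to a factor that it divides. Then [part phi i] divides [F i], and comparing
    the products over [i] leaves only constant cofactors. *)
Let fclass_surj F : is_real_factorization a f F ->
  exists phi, rescaled (factorization phi) F.
Proof.
case=> szF prodF.
have /choice[phi0 phiP] j : exists i, q j %| F i.
  apply: irreducible_dvdp_prod => //; rewrite prodF dvdpZr //.
  by rewrite (bigD1 j) //= dvdp_mulr.
pose phi : {ffun J -> 'I_k} := finfun phi0; exists phi.
apply: rescaled_trans (rescaled_sym _ _ (factorization_rescaled phi)) _.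
have /choice[h hP] i : exists h, F i = h * part phi i.
  apply/dvdpP; apply: prod_dvdp_coprime => // j.
  by rewrite ffunE => /eqP <-.
have prodq0 : \prod_j q j != 0.
  by rewrite -size_poly_gt0 size_prod_irreducible.
have ch : \prod_i h i = c%:P.
  apply: (mulIf prodq0); rewrite mul_polyC -/f -prodF -(prod_part phi).
  by rewrite -big_split; apply: eq_bigr => i _.
(* Each [h i] divides the nonzero constant [c], hence is itself a nonzero constant. *)
have /choice[d dP] i : exists d, d != 0 /\ h i = d%:P.
  have /size_poly1P[d d0 hd] : size (h i) == 1%N; last by exists d.
  rewrite -dvdp1 -(dvdpZr _ _ c_neq0) alg_polyC -ch (bigD1 i) //=.
  exact: dvdp_mulr.
exists d => i; first by case: (dP i).
by rewrite ffunE hP (dP i).2 mul_polyC.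
Qed.

Lemma real_factorizationsE :
  real_factorizations a f = ((fclass \o factorization) @` [set` good])%classic.
Proof.
apply/seteqP; split=> [_ [F FP <-]|_ [phi gphi <-]].
  have [phi phiF] := fclass_surj _ FP; exists phi => /=.
    have [szF prodF] := FP; have [d d0 E] := phiF.
    rewrite inE; apply/forallP => i; rewrite -eqSS -szF E size_scale //.
    rewrite ffunE size_scale ?size_prod_irreducible //.
    by case: ifP => _ //; rewrite oner_eq0.
  apply/seteqP; split=> G [GP resc]; split=> //; apply: rescaled_trans resc => //.
  exact: rescaled_sym.
by exists (factorization phi) => //; apply/factorizationP.
Qed.

Lemma finite_real_factorizations : finite_set (real_factorizations a f).
Proof. by rewrite real_factorizationsE; apply: finite_image; apply: finite_finset. Qed.

Lemma num_real_factorizationsE : num_real_factorizations a f = #|good|.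
Proof.
have fin_good : finite_set [set` good]%classic by apply: finite_finset.
rewrite /num_real_factorizations real_factorizationsE fset_set_image //.
rewrite card_in_imfset /=.
  rewrite (_ : fset_set _ = [fset phi in good]%fset) ?card_finset //.
  apply/fsetP => phi.
  by rewrite in_fset_set // mem_setE !inE.
move=> phi psi; rewrite !in_fset_set // => /set_mem /factorizationP Fphi _.
exact: fclass_inj.
Qed.

End CountFactorizations.

(** * Monic real irreducible factors from the complex roots *)

Section RealDecomposition.
Variable R : realType.
Implicit Types (f : {poly R}) (z : R[i]).
Local Open Scope ring_scope.
Local Open Scope complex_scope.

(** The product of [X - z] and [X - conjc z], written with real coefficients. *)
Definition conj_pair_poly z : {poly R} :=
  ('X - (complex.Re z)%:P) ^+ 2 + (complex.Im z ^+ 2)%:P.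

Lemma size_conj_pair_poly z : size (conj_pair_poly z) = 3.
Proof.
by rewrite size_polyDl size_exp_XsubC // (leq_ltn_trans (size_polyC_leq1 _)).
Qed.

Lemma conj_pair_poly_monic z : conj_pair_poly z \is monic.
Proof.
rewrite monicE lead_coefDl ?size_exp_XsubC.
  by rewrite lead_coef_exp lead_coefXsubC expr1n.
by rewrite (leq_ltn_trans (size_polyC_leq1 _)).
Qed.

(** At a real point the value is a square plus a positive number, and a quadratic without roots is
    irreducible. *)
Lemma conj_pair_poly_irreducible z : complex.Im z != 0 ->
  irreducible_poly (conj_pair_poly z).
Proof.
move=> z0; apply: cubic_irreducible; first by rewrite size_conj_pair_poly.
move=> x; rewrite rootE !hornerE gt_eqF // ltr_wpDl ?sqr_ge0 //.
by rewrite exprn_even_gt0.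
Qed.

Lemma complex_conj_pair_poly z :
  complex_poly (conj_pair_poly z) = ('X - z%:P) * ('X - (conjc z)%:P).
Proof.
rewrite /complex_poly rmorphD rmorphXn /= map_polyXsubC map_polyC /=.
pose v := 0 +i* complex.Im z; pose u := (complex.Re z)%:C.
have -> : (complex.Im z ^+ 2)%:C = - v ^+ 2 by rewrite /v !expr2; simpc.
have -> : conjc z = u - v by rewrite /u /v; case: (z) => x y /=; simpc.
have -> : 'X - z%:P = 'X - (u + v)%:P.
  by congr (_ - _%:P); rewrite /u /v; case: (z) => x y /=; simpc.
by rewrite polyCN polyC_exp polyCD polyCB; ring.
Qed.

Lemma conj_pair_poly_inj :
  {in [pred z | 0 < complex.Im z] &, injective conj_pair_poly}.
Proof.
move=> z z'; rewrite !inE => z0 z'0 E.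
have: root (complex_poly (conj_pair_poly z')) z.
  by rewrite -E complex_conj_pair_poly rootM root_XsubC eqxx.
rewrite complex_conj_pair_poly rootM !root_XsubC => /orP[/eqP //|/eqP zE].
move: z0; rewrite zE; case: (z') z'0 => x y /= y0.
by rewrite oppr_gt0 ltNge ltW.
Qed.

Lemma mem_rootsR f x : f != 0 -> (x \in rootsR f) = root f x.
Proof. by move/roots_on_rootsR <-; rewrite in_itv. Qed.

Lemma root_complex_conj f z :
  root (complex_poly f) (conjc z) = root (complex_poly f) z.
Proof.
rewrite -complex_root_conj /complex_poly; congr root.
by apply/polyP => i; rewrite !coef_map; apply: conjc_real.
Qed.

(** The list [ws] holds one root from each conjugate pair. The condition on imaginary parts yields
    irreducibility; that the [ws] are roots of [f] forces [ws] to be empty when all roots are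
    real. *)
Lemma real_decomposition f : f != 0 -> distinct_complex_roots f ->
  exists (ws : seq R[i])
    (qs := [seq 'X - x%:P | x <- rootsR f] ++ map conj_pair_poly ws),
  [/\ f = lead_coef f *: \prod_(q <- qs) q, uniq qs,
      all [pred w | 0 < complex.Im w] ws &
      forall w, w \in ws -> root (complex_poly f) w].
Proof.
move=> f0 [rs uniq_rs fE].
have lc : lead_coef (complex_poly f) = (lead_coef f)%:C by rewrite lead_coef_map.
have lc0 : lead_coef (complex_poly f) != 0 by rewrite lc fmorph_eq0 lead_coef_eq0.
have mem_rs z : (z \in rs) = root (complex_poly f) z.
  by rewrite fE rootZ // root_prod_XsubC.
pose ws := [seq w <- rs | 0 < complex.Im w]; exists ws => qs.
have wsP : all [pred w | 0 < complex.Im w] ws by apply: filter_all.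
have root_ws w : w \in ws -> root (complex_poly f) w.
  by rewrite mem_filter mem_rs => /andP[].
(* The roots split into real ones, those in the open upper half-plane, and the conjugates of the
   latter. *)
have perm_rs : perm_eq rs
    ([seq x%:C | x <- rootsR f] ++ ws ++ map conjc ws).
  have im_rs x : x \in rootsR f -> x%:C \in rs.
    by rewrite mem_rootsR // mem_rs fmorph_root.
  have conjI := can_inj (@conjcK R).
  apply: uniq_perm => // [|z].
    rewrite !cat_uniq !map_inj_uniq ?uniq_roots ?filter_uniq //=;
      last exact: complexI.
    rewrite andbT; apply/andP; split; apply/hasPn => z.
      rewrite mem_cat => zws; apply/mapP => -[x _ zx]; move: zws; rewrite zx.
      rewrite mem_filter ltxx /= => /mapP[w]; rewrite mem_filter => /andP[w0 _].
      by case: w w0 => u v /= v0 [_ /eqP]; rewrite eq_sym oppr_eq0 gt_eqF.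
    move=> /mapP[w wws ->]; rewrite mem_filter; apply/negP => /andP[].
    move: wws; rewrite mem_filter => /andP[]; case: w => u v /= v0 _.
    by rewrite oppr_gt0 => /(lt_trans v0); rewrite ltxx.
  rewrite !mem_cat mem_rs; apply/idP/or3P => [rz|].
    have [z0|z0|z0] := ltgtP 0 (complex.Im z).
    - by apply: Or32; rewrite mem_filter z0 mem_rs.
    - apply: Or33; apply/mapP; exists (conjc z); last by rewrite conjcK.
      rewrite mem_filter mem_rs root_complex_conj rz andbT.
      by case: (z) z0 => u v /=; rewrite oppr_gt0.
    - have zE : z = (complex.Re z)%:C by case: (z) z0 => u v /= <-.
      apply: Or31; apply/mapP; exists (complex.Re z).
        rewrite mem_rootsR // -(fmorph_root (real_complex R)) /=.
        by move: rz; rewrite zE.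
      exact: zE.
  case=> [/mapP[x xf ->]|/root_ws //|/mapP[w /root_ws rw ->]].
    by rewrite -mem_rs im_rs.
  by rewrite root_complex_conj.
split=> //.
  (* The identity is checked over the complex numbers, where each quadratic splits into its two
     conjugate factors. *)
  apply: (map_poly_inj (real_complex R)).
  rewrite -/(complex_poly f) fE lc (perm_big _ perm_rs) /=.
  rewrite linearZ /= rmorph_prod /=; congr (_ *: _).
  rewrite /qs !big_cat !big_map /=; congr (_ * _).
    by apply: eq_bigr => x _; rewrite map_polyXsubC.
  by rewrite -big_split; apply: eq_bigr => w _; apply/esym/complex_conj_pair_poly.
rewrite cat_uniq !map_inj_in_uniq ?uniq_roots ?filter_uniq //=.
- rewrite andbT; apply/hasPn => _ /mapP[w _ ->]; apply/mapP => -[x _ E].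
  by have := size_conj_pair_poly w; rewrite E size_XsubC.
- by move=> w w' /(allP wsP) w0 /(allP wsP); apply: conj_pair_poly_inj.
- move=> x y _ _ /(congr1 (fun p => p.[x])); rewrite !hornerE subrr.
  by move/esym/eqP; rewrite subr_eq0 => /eqP.
Qed.
End RealDecomposition.

Local Open Scope classical_set_scope.
Local Open Scope card_scope.

(** * The count as a function of the number of real roots *)

Section CountByRealRoots.
Variables (R : realType) (k : nat) (a : 'I_k -> nat) (i0 : 'I_k).
Implicit Type f : {poly R}.

(** Here [s] is the number of conjugate pairs. The degree equation determines it from the number of
    real roots, so the latter alone determines the count. *)
Lemma count_real_factorizations f : admissible a f ->
  exists s, [/\ finite_set (real_factorizations a f),
    num_real_roots f + s.*2 = \sum_i a i,
    num_real_factorizations a f = fillings12 a (num_real_roots f) s &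
    all_roots_real f -> s = 0].
Proof.
case=> szf roots_f.
have f0 : f != 0%R by rewrite -size_poly_gt0 szf.
have [ws [fE uniq_qs wsP root_ws]] := real_decomposition _ _ f0 roots_f.
have ws_nil : all_roots_real f -> ws = [::].
  case: (ws) wsP root_ws => // -[x y] ? /= /andP[y0 _] root_ws real_f.
  have := real_f _ (root_ws _ (mem_head _ _)).
  by rewrite complex_real gt_eqF.
set qs := (_ ++ _)%SEQ in fE uniq_qs; exists (size ws) => {root_ws}.
have qsP p : p \in qs -> p \is monic /\ irreducible_poly p.
  rewrite mem_cat => /orP[/mapP[x _ ->]|/mapP[w wws ->]].
    by rewrite monicXsubC; split=> //; apply: irredp_XsubC.
  split; first exact: conj_pair_poly_monic.
  by apply: conj_pair_poly_irreducible; rewrite gt_eqF //; apply: (allP wsP).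
pose degs := [seq (size p).-1 | p : {poly R} <- qs].
have degsE : degs = nseq (num_real_roots f) 1 ++ nseq (size ws) 2.
  rewrite /degs map_cat -!map_comp; congr (_ ++ _).
    by rewrite /num_real_roots; elim: rootsR => //= x s ->; rewrite size_XsubC.
  by elim: (ws) => //= w s ->; rewrite size_conj_pair_poly.
(* Indexing by [size degs] makes the assignments have the very type used in [card_fillings]. *)
pose q (j : 'I_(size degs)) := (qs`_j)%R.
have lt_qs (j : 'I_(size degs)) : j < size qs.
  by rewrite -(size_map (fun p : {poly R} => (size p).-1)).
have q_irr j : irreducible_poly (q j) by case: (qsP _ (mem_nth 0%R (lt_qs j))).
(* If not coprime, the two irreducibles are associate, hence equal because monic, against
   [uniq_qs]. *)
have q_coprime j j' : j != j' -> coprimep (q j) (q j').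
  apply: contraNT; rewrite irreducible_poly_coprime // negbK => qq.
  have [size_q _] := q_irr j.
  have := apply_irredp (q_irr j') (negbT (gtn_eqF size_q)) qq.
  rewrite eqp_monic; first last.
  - by case: (qsP _ (mem_nth 0%R (lt_qs j'))).
  - by case: (qsP _ (mem_nth 0%R (lt_qs j))).
  by rewrite nth_uniq.
have lc0 : lead_coef f != 0%R by rewrite lead_coef_eq0.
have fE' : f = (lead_coef f *: \prod_j q j)%R.
  by rewrite {1}fE (big_nth 0%R) big_mkord /q /degs size_map.
split.
- rewrite fE'; exact: finite_real_factorizations.
- apply/eqP; rewrite -eqSS -szf [X in _ == size (polyseq X)]fE' size_scale //.
  rewrite size_prod_irreducible // eqSS.
  have -> : \sum_j (size (q j)).-1 = sumn degs.
    rewrite sumnE (big_nth 0) big_mkord; apply: eq_bigr => j _.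
    by rewrite (nth_map 0%R).
  by rewrite degsE sumn_cat !sumn_nseq mul1n mul2n.
- rewrite {1}fE' num_real_factorizationsE //.
  rewrite /fillings12 -degsE -card_fillings; apply: eq_card => phi; rewrite !inE.
  apply: eq_forallb => i; congr (_ == _); apply: eq_bigr => j _.
  by rewrite (nth_map 0%R).
by move/ws_nil ->.
Qed.

(** The degree is both [t + 2h] and [r + 2s], for [r] real roots and [s] pairs. A nonzero count
    forces [t <= r], so [r = t + 2m] and [s = h - m] with [m <= h]: every nonzero value is the image
    of some [m] in [0..h]. *)
Lemma card_nonzero_values : nonzero_values R a #<= `I_(1 + \sum_(i < k) (a i)./2)%N.
Proof.
set h := (\sum_(i < k) _); set t := \sum_i odd (a i).
apply: card_le_trans (card_image_le (fun m => fillings12 a (t + m.*2) (h - m)) _).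
apply: subset_card_le => _ [[f adm <-] /= ne0].
have [s [_ rs nE _]] := count_real_factorizations f adm.
have := fillings12_odd k a (num_real_roots f) s; rewrite -nE => tr.
have {}tr : t <= num_real_roots f by apply: tr; apply/eqP.
have := sum_oddE k a; rewrite -/t -/h -rs => E.
exists ((num_real_roots f - t)./2).
  by rewrite /=; lia.
by rewrite nE; congr fillings12; lia.
Qed.

End CountByRealRoots.

Theorem theorem7p8 (R : realType) (k : nat) (a : 'I_k -> nat)
    (k_gt0 : (0 < k)%N) (a_gt0 : forall i, (0 < a i)%N) :
  let n := fun f : {poly R} => num_real_factorizations a f in
  let lower := multinomial ((\sum_(i < k) a i)./2)%N (fun i => (a i)./2) in
  let upper := multinomial (\sum_(i < k) a i)%N a in
  (forall f : {poly R}, admissible a f -> finite_set (real_factorizations a f))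
  /\ (forall f g : {poly R}, admissible a f -> admissible a g ->
        num_real_roots f = num_real_roots g -> n f = n g)
  /\ (forall f : {poly R}, admissible a f -> (lower <= n f <= upper)%N)
  /\ (forall f : {poly R}, admissible a f ->
        (num_real_roots f <= 1)%N -> n f = lower)
  /\ (forall f : {poly R}, admissible a f -> all_roots_real f -> n f = upper)
  /\ nonzero_values R a #<= `I_(1 + \sum_(i < k) (a i)./2)%N.
Proof.
(* The factor of index [i0] will carry the leading coefficient. *)
move=> n lower upper; have i0 := Ordinal k_gt0.
have count f := count_real_factorizations R k a i0 f.
split=> [f /count[s []] //|]; split.
  move=> f g /count[s [_ sf nf _]] /count[t [_ tg ng _]] fg.
  by rewrite /n nf ng -fg; congr fillings12; lia.
split.
  move=> f /count[s [_ sf nf _]]; set r := num_real_roots f in sf nf.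
  apply/andP; split; rewrite /n nf.
    (* Lower bound: pairing off the [r] unit items leaves [odd r] of them, the minimal case;
       splitting the [r./2] pairs again can only increase the count. *)
    have rE : r = r./2.*2 + odd r by lia.
    rewrite /lower -(@fillings12_min _ _ (odd r) (r./2 + s)); last by case: odd.
      by rewrite {3}rE; apply: fillings12_le.
    by lia.
  (* Upper bound: splitting all [s] items of weight 2 leaves only unit items. *)
  rewrite /upper -fillings12_max -sf addnC -[s in leqLHS]addn0.
  exact: fillings12_le.
split.
  move=> f /count[s [_ sf nf _]] r1.
  by rewrite /n nf; apply: fillings12_min.
split; last exact: card_nonzero_values.
move=> f /count[s [_ sf nf s0]] /s0 s0E.
by rewrite /n /upper nf -fillings12_max -sf s0E addn0.
Qed.
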